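(* If $\mathcal{A}\subseteq\mathbb{Z}^+$ is a finite nonempty set, then \[ \omega_{\mathbb{N}}\Big(\prod_{\substack{a,b\in\mathcal{A}\\ a\ne b}}(a^2-ab+b^2)\Big)>\frac{\log|\mathcal{A}|-\log 38}{2\log 3}. \]
   Context: $\mathbb{Z}^+$ is the set of positive integers. For a positive integer $N$, $\omega_{\mathbb{N}}(N)$ denotes the number of distinct (positive rational) prime divisors of $N$. An empty product equals $1$. *)

(* Defs.v *)
From mathcomp Require Import all_boot.

Set Implicit Arguments.
Unset Strict Implicit.
Unset Printing Implicit Defensive.

Definition omegaN (N : nat) : nat := size (primes N).

(* Main.v *)
(** If [a <> b] had the same cube "sign" modulo every prime [p] dividing the
    product (the sign telling which half of [Z/p] contains the cube of the
    [p]-free part), then [a = b].  Indeed put [a = g x] and [b = g y] with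
    [x], [y] coprime.  A prime [p] dividing [x^2 - x y + y^2 > 1] divides neither
    [x] nor [y], and it divides [x^3 + y^3], so the cubes of the [p]-free parts of
    [a] and [b] are opposite nonzero residues; as [p] is odd they lie in
    different halves.  Hence [#|A| <= 2 ^ omega]. *)
Require Import Defs.
From mathcomp Require Import all_boot all_order all_algebra.
From mathcomp Require Import finmap.
From mathcomp Require Import reals exp.
From mathcomp Require Import zify ring.
Set Implicit Arguments.
Unset Strict Implicit.
Unset Printing Implicit Defensive.
Import Order.TTheory GRing.Theory Num.Theory.
Local Open Scope ring_scope.

(** The norm of [x + y w] in the Eisenstein integers, [w] a primitive cube root of unity.
    Subtracting last keeps the truncated subtraction exact, as [x * y <= x ^ 2 + y ^ 2]. *)
Definition eisenstein_norm (x y : nat) : nat := (x ^ 2 + y ^ 2 - x * y)%N.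

Lemma eisenstein_normD x y :
  (eisenstein_norm x y + x * y = x ^ 2 + y ^ 2)%N.
Proof. by rewrite /eisenstein_norm; nia. Qed.

Lemma abs_eisenstein_norm (x y : nat) :
  `|(x%:Z ^+ 2 - x%:Z * y%:Z + y%:Z ^+ 2)%R|%N = eisenstein_norm x y.
Proof.
have -> : (x%:Z ^+ 2 - x%:Z * y%:Z + y%:Z ^+ 2)%R = (eisenstein_norm x y)%:Z.
  have := congr1 Posz (eisenstein_normD x y).
  rewrite -!mulnn !PoszD !PoszM -!expr2 => E.
  by apply/eqP; rewrite addrAC subr_eq; apply/eqP; rewrite E.
by rewrite absz_nat.
Qed.

Lemma eisenstein_normM g x y :
  eisenstein_norm (g * x) (g * y) = (g ^ 2 * eisenstein_norm x y)%N.
Proof.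
by rewrite /eisenstein_norm mulnBr mulnDr !expnMn; congr (_ - _)%N; ring.
Qed.

Lemma eisenstein_norm_gt1 x y :
  (0 < x)%N -> (0 < y)%N -> x != y -> (1 < eisenstein_norm x y)%N.
Proof. by move=> x0 y0 xy; have := eisenstein_normD x y; nia. Qed.

Lemma eisenstein_norm_gt0 x y : (0 < x)%N -> (0 < eisenstein_norm x y)%N.
Proof. by move=> x0; have := eisenstein_normD x y; nia. Qed.

Lemma dvdn_eisenstein_norm_cube x y :
  (eisenstein_norm x y %| x ^ 3 + y ^ 3)%N.
Proof.
apply/dvdnP; exists (x + y)%N.
have E := eisenstein_normD x y; apply/eqP.
(* Adding [(x + y) * (x * y)] to both sides removes the truncated subtraction. *)
rewrite -(eqn_add2r ((x + y) * (x * y))) -mulnDr E; apply/eqP; ring.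
Qed.

(** If [p] divided one of [x], [y], it would divide [x ^ 2 + y ^ 2], hence the other one too. *)
Lemma dvdn_eisenstein_norm_coprime p x y :
  prime p -> coprime x y -> (p %| eisenstein_norm x y)%N ->
  ~~ (p %| x)%N && ~~ (p %| y)%N.
Proof.
move=> p_pr cxy pq; have E := eisenstein_normD x y.
have /negP np : ~~ ((p %| x) && (p %| y))%N.
  rewrite -dvdn_gcd (eqP cxy) dvdn1; case: eqP p_pr => // -> //.
apply/andP; split; apply/negP => pd; apply: np; rewrite pd ?andbT /=.
- have : (p %| x ^ 2 + y ^ 2)%N by rewrite -E dvdn_addl ?dvdn_mulr.
  by rewrite dvdn_addr !Euclid_dvdX ?pd ?andbT.
- have : (p %| x ^ 2 + y ^ 2)%N by rewrite -E dvdn_addl // dvdn_mull.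
  by rewrite dvdn_addl !Euclid_dvdX ?pd ?andbT.
Qed.

(** An even norm would force [x] and [y] to be odd; then norm plus [x * y] is odd while
    [x ^ 2 + y ^ 2] is even. *)
Lemma odd_eisenstein_norm x y : coprime x y -> odd (eisenstein_norm x y).
Proof.
move=> cxy; apply/negPn/negP; rewrite -dvdn2 => d2.
have /andP[] := @dvdn_eisenstein_norm_coprime 2 x y isT cxy d2.
rewrite dvdn2 in d2; rewrite !dvdn2 !negbK => ox oy.
by have := congr1 odd (eisenstein_normD x y); rewrite !oddD !oddX oddM ox oy (negbTE d2).
Qed.

(** For [p = 2k + 1] the lower half consists of the residues [0, ..., k], whence the bound
    [p./2.+1]. *)
Definition cube_sign (p a : nat) : bool :=
  ((a %/ p ^ logn p a) ^ 3 %% p < p./2.+1)%N.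

Lemma cube_half_neq p x y :
  odd p -> ~~ (p %| x)%N -> (p %| x + y)%N ->
  (x %% p < p./2.+1)%N != (y %% p < p./2.+1)%N.
Proof.
move=> op; rewrite /dvdn -modnDm => nx pxy.
have p0 : (0 < p)%N by case: (p) op.
have hx := ltn_pmod x p0; have hy := ltn_pmod y p0.
move: nx hx hy pxy; move: (x %% p)%N (y %% p)%N => u v nx hx hy pxy.
(* The sum is a multiple of [p] lying strictly between [0] and [2p]. *)
have uv : (u + v = p)%N by have /dvdnP[[|[|k]]] := pxy; move: nx; nia.
have := odd_double_half p; rewrite op => Ep.
by case: (ltnP u) => lu; case: (ltnP v) => lv //; move: nx; lia.
Qed.

Lemma cube_sign_neq p g x y :
  prime p -> (0 < g)%N -> coprime x y -> (p %| eisenstein_norm x y)%N ->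
  cube_sign p (g * x) != cube_sign p (g * y).
Proof.
move=> p_pr g0 cxy pq.
have /andP[npx npy] := dvdn_eisenstein_norm_coprime p_pr cxy pq.
have op : odd p by exact: dvdn_odd pq (odd_eisenstein_norm cxy).
(* A factor prime to [p] passes unchanged into the [p]-free part, so the two cubes share the factor
   coming from [g]. *)
have part z : ~~ (p %| z)%N ->
    (g * z %/ p ^ logn p (g * z) = g %/ p ^ logn p g * z)%N.
  move=> npz; have z0 : (0 < z)%N by case: (z) npz; rewrite ?dvdn0.
  by rewrite lognM // [logn p z]logn_coprime ?prime_coprime // addn0
             divn_mulAC ?pfactor_dvdnn.
rewrite /cube_sign !part //; apply: cube_half_neq => //.
  rewrite Euclid_dvdX // andbT Euclid_dvdM // negb_or npx andbT.
  (* Otherwise [p] would divide [g] to a power exceeding [logn p g]. *)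
  by rewrite dvdn_divRL ?pfactor_dvdnn // -expnS pfactor_dvdn // ltnn.
rewrite !expnMn -mulnDr dvdn_mull //.
exact: dvdn_trans pq (dvdn_eisenstein_norm_cube x y).
Qed.

Lemma cube_sign_separates a b :
  (0 < a)%N -> (0 < b)%N -> a != b ->
  exists p, [/\ prime p, (p %| eisenstein_norm a b)%N
              & cube_sign p a != cube_sign p b].
Proof.
move=> a0 b0 ab; set g := gcdn a b.
have g0 : (0 < g)%N by rewrite gcdn_gt0 a0.
have Ea : (a = g * (a %/ g))%N by rewrite mulnC divnK ?dvdn_gcdl.
have Eb : (b = g * (b %/ g))%N by rewrite mulnC divnK ?dvdn_gcdr.
set x := (a %/ g)%N in Ea; set y := (b %/ g)%N in Eb.
have cxy : coprime x y.
  by rewrite /coprime -(eqn_pmul2l g0) muln_gcdr -Ea -Eb muln1.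
have q1 : (1 < eisenstein_norm x y)%N.
  apply: eisenstein_norm_gt1.
  - by move: a0; rewrite Ea muln_gt0 g0.
  - by move: b0; rewrite Eb muln_gt0 g0.
  - by apply: contra ab => /eqP xy; rewrite Ea Eb xy.
(* The prime is taken from the norm of the coprime pair, which divides that of [a], [b] with
   cofactor [g ^ 2]. *)
exists (pdiv (eisenstein_norm x y)).
rewrite Ea Eb eisenstein_normM; split; first exact: pdiv_prime.
  by rewrite dvdn_mull ?pdiv_dvd.
by apply: cube_sign_neq; rewrite ?pdiv_prime ?pdiv_dvd.
Qed.

Lemma leq_card_exp_omega (A : {fset nat}) (N : nat) :
  (0 < N)%N -> (forall a, a \in A -> (0 < a)%N) ->
  (forall a b, a \in A -> b \in A -> a != b -> (eisenstein_norm a b %| N)%N) ->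
  (#|` A| <= 2 ^ omegaN N)%N.
Proof.
move=> N0 A_pos A_dvd.
(* One bit for each prime divisor of [N]: injectivity of this vector gives the bound
   [2 ^ omegaN N]. *)
pose signs (a : A) := [tuple of map (cube_sign^~ (val a)) (in_tuple (primes N))].
have signs_inj : injective signs.
  move=> a b /(congr1 val) /= E; apply/val_inj/eqP; apply/negPn/negP => ab.
  have [p [p_pr pq /eqP neq]] :=
    cube_sign_separates (A_pos _ (valP a)) (A_pos _ (valP b)) ab.
  (* Positivity of [N] matters here, since [primes 0] is empty. *)
  have pN : p \in primes N.
    rewrite mem_primes p_pr N0 (dvdn_trans pq) //.
    exact: A_dvd (valP a) (valP b) ab.
  by apply: neq; move/eq_in_map: E; apply.
rewrite cardfE /omegaN -card_bool -card_tuple.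
exact: leq_card signs_inj.
Qed.

Theorem corollary1 (R : realType) (A : {fset nat})
    (A_pos : forall a : nat, a \in A -> (0 < a)%N)
    (A_neq0 : A != fset0) :
  (ln (#|` A|%:R : R) - ln 38%:R) / (2%:R * ln 3%:R) <
  (omegaN `|(\prod_(a <- A) \prod_(b <- A | a != b)
              (a%:Z ^+ 2 - a%:Z * b%:Z + b%:Z ^+ 2))%R|%N)%:R.
Proof.
set N := `|_|%N.
have EN : N = (\prod_(a <- A) \prod_(b <- A | a != b) eisenstein_norm a b)%N.
  rewrite /N (big_morph absz abszM absz1); apply: eq_bigr => a _.
  rewrite (big_morph absz abszM absz1); apply: eq_bigr => b _.
  exact: abs_eisenstein_norm.
have N0 : (0 < N)%N.
  rewrite EN big_seq prodn_cond_gt0 // => a aA.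
  by rewrite prodn_cond_gt0 // => b _; rewrite eisenstein_norm_gt0 ?A_pos.
have A_dvd a b : a \in A -> b \in A -> a != b -> (eisenstein_norm a b %| N)%N.
  move=> aA bA ab; rewrite EN (big_rem a) //= (big_rem b) //= ab.
  by rewrite -mulnA dvdn_mulr.
have cardA := leq_card_exp_omega N0 A_pos A_dvd.
have ln3_gt0 : 0 < ln 3%:R :> R by rewrite ln_gt0 // ltr1n.
(* The exponentiated form of the goal, with [9 = 3 ^ 2] from [2 log 3]; the factor [38] makes it
   strict. *)
have lt9 : (#|` A| < 38 * 9 ^ omegaN N)%N.
  apply: leq_ltn_trans cardA _.
  have : (2 ^ omegaN N <= 9 ^ omegaN N)%N by case: (omegaN N) => // n; rewrite leq_exp2r.
  by have := expn_gt0 9 (omegaN N); lia.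
have A0 : (0 < #|` A|)%N by rewrite cardfs_gt0.
rewrite ltr_pdivrMr ?mulr_gt0 // ltrBlDr.
have -> : (omegaN N)%:R * (2%:R * ln 3%:R) = ln ((9 ^ omegaN N)%N%:R) :> R.
  have -> : 9%N = (3 ^ 2)%N by [].
  by rewrite -expnM natrX lnXn ?ltr0n // mulrA -natrM mulr_natl mulnC.
rewrite addrC -lnM ?posrE ?ltr0n ?expn_gt0 // -natrM.
by rewrite ltr_ln ?posrE ?ltr0n ?muln_gt0 ?expn_gt0 // ltr_nat.
Qed.
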